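(* Let $H$ be a complex Hilbert space, let $\{f_k\}_{k=1}^\infty$ and $\{g_k\}_{k=1}^\infty$ be sequences in $H$, and let $G$ be the cross-Gram operator associated to $\{\langle f_k,g_j\rangle\}_{j,k=1}^\infty$. Then the following hold: (i) If $G$ is well-defined and bounded above and $\{g_k\}_{k=1}^\infty$ is a frame for $H$ with lower bound $A$, then $\{f_k\}_{k=1}^\infty$ is norm-bounded above. (ii) If $G$ is well-defined and bounded below and $\{g_k\}_{k=1}^\infty$ is a Bessel sequence with upper bound $B$, then $\{f_k\}_{k=1}^\infty$ is norm-bounded below. (iii) If $G$ is well-defined and bounded above and $\{f_k\}_{k=1}^\infty$ is an orthonormal basis for $H$, then $\{g_k\}_{k=1}^\infty$ is a Bessel sequence for $H$.
   Context: Inner products are linear in the first argument. A sequence $\{g_k\}_{k=1}^\infty\subset H$ is a frame for $H$ with lower bound $A>0$ and upper bound $B>0$ if $A\|f\|^2\le\sum_{k=1}^\infty|\langle f,g_k\rangle|^2\le B\|f\|^2$ for all $f\in H$; it is a Bessel sequence with (upper) bound $B$ if the second inequality holds for all $f\in H$. The cross-Gram operator $G$ associated to $\{\langle f_k,g_j\rangle\}_{j,k=1}^\infty$ is the operator on $\ell^2(\mathbb{N})$ given by $G\{c_k\}_{k=1}^\infty=\left\{\sum_{k=1}^\infty c_k\langle f_k,g_j\rangle\right\}_{j=1}^\infty$. It is well-defined if for every $\{c_k\}\in\ell^2(\mathbb{N})$ these series converge and the resulting sequence lies in $\ell^2(\mathbb{N})$. It is bounded above if there is $M>0$ with $\|Gc\|^2\le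 M\|c\|^2$ for all $c\in\ell^2(\mathbb{N})$, and bounded below if there is $M'>0$ with $M'\|c\|^2\le\|Gc\|^2$ for all $c\in\ell^2(\mathbb{N})$. The sequence $\{f_k\}$ is norm-bounded above if $\sup_k\|f_k\|<\infty$ and norm-bounded below if $\inf_k\|f_k\|>0$. *)

(* Defs.v *)
From mathcomp Require Import all_boot all_order all_algebra.
From mathcomp Require Import complex.
From mathcomp Require Import all_classical all_reals all_analysis.

Set Implicit Arguments.
Unset Strict Implicit.
Unset Printing Implicit Defensive.

Import Order.TTheory GRing.Theory Num.Theory.
Import numFieldNormedType.Exports.

Local Open Scope classical_set_scope.
Local Open Scope ring_scope.

(* Norms over the scalar field R[i] take values in R[i]; [rnorm] is the same
   norm as an element of R.  It also applies to the scalars themselves, where it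
   is the modulus. *)
Definition rnorm (R : realType) (V : normedZmodType R[i]) (x : V) : R :=
  complex.Re `|x|.

(* A complex Hilbert space is a complete normed R[i]-module whose norm is
   induced by a positive definite form; a form in {dot H for Num.conj} is linear
   in its first argument and conjugate-linear in its second one. *)
Definition induces_norm (R : realType) (H : completeNormedModType R[i])
    (dot : {dot H for Num.conj}) : Prop :=
  forall x : H, `|x| ^+ 2 = dot x x.

Definition l2sqnorm (R : realType) (c : nat -> R[i]) : \bar R :=
  (\sum_(0 <= k <oo) (rnorm (c k) ^+ 2)%:E)%E.

Definition l2 (R : realType) (c : nat -> R[i]) : Prop := (l2sqnorm c < +oo)%E.

Section Hilbert.
Variables (R : realType) (H : completeNormedModType R[i]).
Variable dot : {dot H for Num.conj}.
Implicit Types (f g : nat -> H) (c : nat -> R[i]).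

Definition bessel_bound g (B : R) : Prop :=
  0 < B /\
  forall x : H, (l2sqnorm (fun k => dot x (g k)) <= (B * rnorm x ^+ 2)%:E)%E.

Definition bessel g : Prop := exists B : R, bessel_bound g B.

Definition frame_bounds g (A B : R) : Prop :=
  [/\ 0 < A,
      forall x : H,
        ((A * rnorm x ^+ 2)%:E <= l2sqnorm (fun k => dot x (g k)))%E
    & bessel_bound g B].

Definition frame_lower_bound g (A : R) : Prop :=
  exists B : R, frame_bounds g A B.

Definition cross_gram_terms f g c (j : nat) : nat -> (R[i])^o :=
  fun k => c k * dot (f k) (g j).

(* [limn] is a junk value when the series diverges; see
   [cross_gram_well_defined]. *)
Definition cross_gram f g c : nat -> R[i] :=
  fun j => limn (series (cross_gram_terms f g c j)).

Definition cross_gram_well_defined f g : Prop :=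
  forall c, l2 c ->
    (forall j, cvgn (series (cross_gram_terms f g c j))) /\
    l2 (cross_gram f g c).

Definition cross_gram_bounded_above f g : Prop :=
  exists2 M : R, 0 < M &
    forall c, l2 c -> (l2sqnorm (cross_gram f g c) <= M%:E * l2sqnorm c)%E.

Definition cross_gram_bounded_below f g : Prop :=
  exists2 M' : R, 0 < M' &
    forall c, l2 c -> (M'%:E * l2sqnorm c <= l2sqnorm (cross_gram f g c))%E.

Definition norm_bounded_above f : Prop :=
  (ereal_sup (range (fun k => (rnorm (f k))%:E)) < +oo)%E.

Definition norm_bounded_below f : Prop :=
  (0 < ereal_inf (range (fun k => (rnorm (f k))%:E)))%E.

(* An orthonormal system that is a (Schauder) basis: every vector has a unique
   norm-convergent expansion. *)
Definition orthonormal_basis f : Prop :=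
  (forall j k, dot (f j) (f k) = (j == k)%:R) /\
  (forall x : H, exists! c : nat -> R[i],
     series (fun k => c k *: f k) @ \oo --> x).

End Hilbert.

(* Main.v *)
(** G maps the unit vector e_k to (<f_k, g_j>)_j, so the bounds on G control
    sum_j |<f_k, g_j>|^2, which the frame or Bessel bounds compare with
    |f_k|^2; this gives (i) and (ii).  For (iii), expand x in the orthonormal
    basis f: its coefficients are c = (<x, f_k>)_k, with |c| <= |x| by Bessel's
    inequality, and G c = (<x, g_j>)_j by continuity of the inner product. *)

Require Import Defs.
From mathcomp Require Import all_boot all_order all_algebra.
From mathcomp Require Import complex.
From mathcomp Require Import all_classical all_reals all_analysis.

Import Order.TTheory GRing.Theory Num.Theory.
Import numFieldNormedType.Exports.
Local Open Scope ring_scope.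

Section ComplexNorm.
Variables (R : realType) (V : normedZmodType R[i]).
Implicit Types x : V.

Lemma rnormE x : (rnorm x)%:C%C = `|x|.
Proof. by rewrite /rnorm RRe_real// realE normr_ge0. Qed.

Lemma rnorm_ge0 x : 0 <= rnorm x.
Proof. by rewrite -ler0c rnormE. Qed.

End ComplexNorm.

Definition delta_seq (R : realType) (k : nat) : nat -> R[i] :=
  fun i => (i == k)%:R.

Lemma l2sqnorm_delta (R : realType) (k : nat) :
  l2sqnorm (delta_seq R k) = 1%E.
Proof.
rewrite /l2sqnorm (@nneseriesD1 _ _ k)//=; last first.
  by move=> n _; rewrite lee_fin exprn_ge0// rnorm_ge0.
rewrite eseries0 ?adde0; last first.
  by move=> i _ /= ik; rewrite /delta_seq (negbTE ik) /rnorm normr0 expr0n.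
by rewrite /delta_seq eqxx /rnorm normr1 expr1n.
Qed.

Lemma l2_delta (R : realType) (k : nat) : l2 (delta_seq R k).
Proof. by rewrite /l2 l2sqnorm_delta ltry. Qed.

Lemma l2sqnorm_le (R : realType) (c : nat -> R[i]) (b : R) :
  (forall n, \sum_(0 <= k < n) rnorm (c k) ^+ 2 <= b) ->
  (l2sqnorm c <= b%:E)%E.
Proof.
move=> cb; apply: lime_le.
  apply: is_cvg_nneseries => n _ _.
  by rewrite lee_fin exprn_ge0// rnorm_ge0.
by apply: nearW => n; rewrite sumEFin lee_fin.
Qed.

Section InnerProduct.
Variables (R : realType) (H : completeNormedModType R[i]).
Variable dot : {dot H for Num.conj}.
Hypothesis Hdot : induces_norm dot.
Implicit Types (u v x y : H) (f g : nat -> H).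

Lemma dnormDZ (a : R[i]) u v : dot u v = 0 ->
  dot (u + a *: v) (u + a *: v) = dot u u + `|a| ^+ 2 * dot v v.
Proof.
move=> ouv; have ouav : dot u (a *: v) = 0 by rewrite linearZr_LR/= ouv mulr0.
by rewrite hnormDd// -(dnormZ dot a v).
Qed.

(** Split [u] into its projection [a *: v] and a remainder [w] orthogonal to [v]. By Pythagoras, the
    two sides, once squared, differ by [dot w w * dot v v], which is nonnegative. *)
Lemma induced_CauchySchwarz u v : `|dot u v| <= `|u| * `|v|.
Proof.
have [->|v0] := eqVneq v 0; first by rewrite linear0r !normr0 mulr0.
rewrite -(@ler_pXn2r _ 2) ?nnegrE ?mulr_ge0// exprMn !Hdot.
have dv0 : dot v v != 0 by rewrite dnorm_eq0.
pose a := dot u v / dot v v; pose w := u - a *: v.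
have ow : dot w v = 0.
  by rewrite /w linearBl/= linearZl_LR/= divfK ?subrr.
have -> : u = w + a *: v by rewrite subrK.
rewrite dnormDZ// linearDl/= ow add0r linearZl_LR/=.
rewrite normrM (ger0_norm (dnorm_ge0 _ _)) exprMn mulrDl.
by rewrite [dot v v ^+ 2]expr2 mulrA lerDr mulr_ge0// dnorm_ge0.
Qed.

Lemma cvg_dotl (F : nat -> H) x y : (F n @[n --> \oo] --> x)%classic ->
  (dot (F n) y @[n --> \oo] --> (dot x y : R[i]^o))%classic.
Proof.
move=> Fx; apply/cvgrPdist_lt => e e0.
(* Adding 1 keeps the divisor of [e] positive even when [y = 0]. *)
have y0 : 0 < `|y| + 1 by rewrite ltr_wpDl.
have /cvgrPdist_lt/(_ (e / (`|y| + 1)) (divr_gt0 e0 y0)) := Fx.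
apply: filterS => n.
rewrite ltr_pdivlMr// => xe.
rewrite -linearBl; apply: le_lt_trans xe.
by rewrite (le_trans (induced_CauchySchwarz _ _))// ler_wpM2l// lerDl.
Qed.

Lemma dot_orthonormal_sum f (c : nat -> R[i]) n j :
  (forall j k, dot (f j) (f k) = (j == k)%:R) ->
  dot (\sum_(0 <= k < n) c k *: f k) (f j) = if (j < n)%N then c j else 0.
Proof.
move=> orthof; elim: n => [|n IHn]; first by rewrite big_nil linear0l.
rewrite big_nat_recr//= linearDl/= IHn linearZl_LR/= orthof.
rewrite ltnS [(j <= n)%N]leq_eqVlt.
have [<-|nj] := eqVneq n j; first by rewrite ltnn add0r mulr1.
by rewrite mulr0 addr0.
Qed.

(** Bessel's inequality, from an exact identity: the squared norm of [x] is that of the residual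
    [r m] plus the sum of the first [m] squared coefficients. *)
Lemma orthonormal_bessel_le f x n :
  (forall j k, dot (f j) (f k) = (j == k)%:R) ->
  \sum_(0 <= k < n) rnorm (dot x (f k)) ^+ 2 <= rnorm x ^+ 2.
Proof.
move=> orthof.
pose r m := x - \sum_(0 <= k < m) dot x (f k) *: f k.
suff Dr m : dot x x =
    dot (r m) (r m) + \sum_(0 <= k < m) `|dot x (f k)| ^+ 2.
  rewrite -lecR rmorph_sum/= rmorphXn/= rnormE Hdot (Dr n).
  rewrite -[leLHS]add0r lerD ?dnorm_ge0//.
  by apply: ler_sum => k _; rewrite rmorphXn/= rnormE.
elim: m => [|m ->]; first by rewrite /r !big_nil subr0 addr0.
(* Passing to [m.+1] splits off the component of [r m] along [f m], which is orthogonal to the new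
   residual, so Pythagoras applies. *)
have rS : r m = r m.+1 + dot x (f m) *: f m.
  by rewrite /r big_nat_recr//= opprD addrA subrK.
have rf : dot (r m.+1) (f m) = 0.
  by rewrite /r linearBl/= dot_orthonormal_sum// ltnSn subrr.
rewrite {1 2}rS dnormDZ// big_nat_recr//= orthof eqxx mulr1.
by rewrite -addrA [in RHS](addrC (\sum_(0 <= k < m) _)).
Qed.

(** Pairing the partial sums with [f j] gives [c j] as soon as the term of index [j] is included,
    and the pairing passes to the limit. *)
Lemma orthonormal_expansion_coef f x (c : nat -> R[i]) j :
  (forall j k, dot (f j) (f k) = (j == k)%:R) ->
  (series (fun k => c k *: f k) @ \oo --> x)%classic -> c j = dot x (f j).
Proof.
move=> orthof cx; symmetry; have cfx := cvg_dotl _ _ (f j) cx.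
apply: (cvg_unique (@norm_hausdorff _ (R[i]^o : normedModType R[i])) cfx).
apply: cvg_near_cst; exists j.+1 => // n /= jn.
by rewrite /series/= dot_orthonormal_sum// jn.
Qed.

Lemma cross_gram_delta f g (k : nat) :
  cross_gram dot f g (delta_seq R k) = (fun j => dot (f k) (g j)).
Proof.
apply/funext => j.
apply: (lim_near_cst (@norm_hausdorff _ (R[i]^o : normedModType R[i]))).
(* From [k.+1] on, a partial sum contains the only nonzero coefficient, the one at [k], so it is
   constant. *)
exists k.+1 => // n /= kn.
rewrite /series/= (bigD1_seq k) ?mem_index_iota ?iota_uniq//=.
rewrite /cross_gram_terms /delta_seq eqxx mul1r big1 ?addr0// => i ik.
by rewrite (negbTE ik) mul0r.
Qed.

Lemma cross_gram_expansion f g x (c : nat -> R[i]) :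
  (series (fun k => c k *: f k) @ \oo --> x)%classic ->
  cross_gram dot f g c = (fun j => dot x (g j)).
Proof.
move=> cx; apply/funext => j.
apply: (cvg_lim (@norm_hausdorff _ (R[i]^o : normedModType R[i]))).
(* By linearity, the partial sums of the Gram series are those of the expansion paired with
   [g j]. *)
rewrite (_ : series _ = fun n => dot (series (fun k => c k *: f k) n) (g j)).
  exact: cvg_dotl.
apply/funext => n; rewrite /series/= linear_sumlz/=.
by apply: eq_bigr => k _; rewrite linearZl_LR.
Qed.

Lemma cross_gram_above_frame_norm_bounded f g A :
  cross_gram_bounded_above dot f g -> frame_lower_bound dot g A ->
  norm_bounded_above f.
Proof.
move=> [M M0 GM] [B [A0 gA _]].
(* The bound comes from A |f_k|^2 <= |G e_k|^2 <= M, as e_k has norm 1. *)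
apply: (@le_lt_trans _ _ (Num.sqrt (M / A))%:E); last exact: ltry.
apply: ge_ereal_sup => _ [k _ <-]; rewrite lee_fin.
rewrite -[leLHS]ger0_norm ?rnorm_ge0// -sqrtr_sqr ler_wsqrtr//.
rewrite ler_pdivlMr// mulrC -lee_fin (le_trans (gA (f k)))//.
have := GM _ (l2_delta R k).
by rewrite cross_gram_delta l2sqnorm_delta mule1.
Qed.

Lemma cross_gram_below_bessel_norm_bounded f g B :
  cross_gram_bounded_below dot f g -> bessel_bound dot g B ->
  norm_bounded_below f.
Proof.
move=> [M M0 GM] [B0 gB].
(* Here M <= |G e_k|^2 <= B |f_k|^2. *)
apply: (@lt_le_trans _ _ (Num.sqrt (M / B))%:E).
  by rewrite lte_fin sqrtr_gt0 divr_gt0.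
apply: le_ereal_inf_tmp => _ [k _ <-]; rewrite lee_fin.
rewrite -[leRHS]ger0_norm ?rnorm_ge0// -sqrtr_sqr ler_wsqrtr//.
rewrite ler_pdivrMr// mulrC -lee_fin (le_trans _ (gB (f k)))//.
have := GM _ (l2_delta R k).
by rewrite cross_gram_delta l2sqnorm_delta mule1.
Qed.

Lemma cross_gram_above_orthonormal_basis_bessel f g :
  cross_gram_bounded_above dot f g -> orthonormal_basis dot f -> bessel dot g.
Proof.
move=> [M M0 GM] [orthof basisf]; exists M; split=> // x.
have [c [cx _]] := basisf x.
have c_le : (l2sqnorm c <= (rnorm x ^+ 2)%:E)%E.
  have -> : c = fun k => dot x (f k).
    by apply/funext => k; exact: orthonormal_expansion_coef.
  by apply: l2sqnorm_le => n; exact: orthonormal_bessel_le.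
(* [c_le] serves twice: it puts [c] in l2, so that [GM] applies, and it then turns M |c|^2 into M
   |x|^2, making [M] itself a Bessel bound. *)
have := GM _ (le_lt_trans c_le (ltry _)).
rewrite (cross_gram_expansion _ _ _ _ cx) => /le_trans; apply.
by rewrite EFinM lee_wpmul2l// lee_fin ltW.
Qed.

End InnerProduct.

Theorem theorem2p5 (R : realType) (H : completeNormedModType R[i])
    (dot : {dot H for Num.conj}) (Hdot : induces_norm dot)
    (f g : nat -> H) :
  (* (i) *)
  (cross_gram_well_defined dot f g -> cross_gram_bounded_above dot f g ->
   forall A : R, frame_lower_bound dot g A -> norm_bounded_above f) /\
  (* (ii) *)
  (cross_gram_well_defined dot f g -> cross_gram_bounded_below dot f g ->
   forall B : R, bessel_bound dot g B -> norm_bounded_below f) /\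
  (* (iii) *)
  (cross_gram_well_defined dot f g -> cross_gram_bounded_above dot f g ->
   orthonormal_basis dot f -> bessel dot g).
Proof.
split=> [_ Gab A gA|]; first exact: cross_gram_above_frame_norm_bounded Gab gA.
split=> [_ Gbe B gB|_ Gab].
  exact: cross_gram_below_bessel_norm_bounded Gbe gB.
exact: cross_gram_above_orthonormal_basis_bessel.
Qed.
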